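(* Let $a<b$ be real numbers, let $M\ge 1$ be an integer, and let $G\colon[a,b]\to\mathbb{R}$ and $H\colon[a,b]\to\mathbb{C}$ be $C^\infty$ functions such that $G$ is strictly monotone on $[a,b]$ and neither $G'$ nor $H$ has a zero in $[a,b]$. Let $x_0\in[a,b]$ be fixed. Let $$f(x)=\sum_{j=1}^{M} c_j\,H(x)\,e^{\alpha_j G(x)},\qquad x\in[a,b],$$ with coefficients $c_j\in\mathbb{C}\setminus\{0\}$ and pairwise different $\alpha_j\in\mathbb{C}$, $j=1,\dots,M$. Then: (i) $f$ is an expansion into eigenfunctions of the first-order differential operator $A$ given by $$(Af)(x)=\frac{1}{G'(x)}\,f'(x)-\frac{H'(x)}{G'(x)H(x)}\,f(x),$$ i.e. each function $H(\cdot)\,e^{\alpha_j G(\cdot)}$, $j=1,\dots,M$, is an eigenfunction of $A$. (ii) $f$ can be uniquely reconstructed from the derivative samples $f^{(\ell)}(x_0)$, $\ell=0,\dots,2M-1$.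
   Context: The functions $G$, $H$, the number of terms $M$ and the point $x_0$ are known; the parameters $c_j,\alpha_j$ are unknown. The operator $A$ acts on complex-valued $C^\infty$ functions on $[a,b]$ (with one-sided derivatives at the endpoints). ''$f$ can be uniquely reconstructed from given samples'' means that the samples determine the set of parameter pairs $\{(\alpha_j,c_j): j=1,\dots,M\}$ uniquely: if $\tilde f(x)=\sum_{j=1}^{M}\tilde c_j H(x)e^{\tilde\alpha_j G(x)}$ is another expansion with $\tilde c_j\in\mathbb{C}\setminus\{0\}$ and pairwise different $\tilde\alpha_j\in\mathbb{C}$ having the same samples, then $\{(\tilde\alpha_j,\tilde c_j)\}=\{(\alpha_j,c_j)\}$, and hence $\tilde f=f$. *)

(* Defs.v *)
From Stdlib Require Import Reals.
From Coquelicot Require Import Coquelicot.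
Open Scope R_scope.

(** Functions on [a,b] are total functions on [R] of which only the values on
    [a,b] are used: [l] is the derivative of [f] at [x] along [a,b], hence the
    one-sided derivative when [x] is an endpoint. *)
Definition is_derive_on {V : NormedModule R_AbsRing}
    (a b : R) (f : R -> V) (x : R) (l : V) : Prop :=
  filterdiff f (within (fun y : R => a <= y <= b) (locally x))
    (fun y : R => scal y l).

Definition ex_derive_on {V : NormedModule R_AbsRing}
    (a b : R) (f : R -> V) (x : R) : Prop :=
  exists l : V, is_derive_on a b f x l.

(** Only meaningful if [ex_derive_on a b f x], with [a < b] and [a <= x <= b]. *)
Definition Derive_on {V : CompleteNormedModule R_AbsRing}
    (a b : R) (f : R -> V) (x : R) : V :=
  iota (is_derive_on a b f x).

Fixpoint Derive_n_on {V : CompleteNormedModule R_AbsRing}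
    (a b : R) (f : R -> V) (n : nat) : R -> V :=
  match n with
  | O => f
  | S n => Derive_on a b (Derive_n_on a b f n)
  end.

Definition smooth_on {V : CompleteNormedModule R_AbsRing}
    (a b : R) (f : R -> V) : Prop :=
  forall (n : nat) (x : R), a <= x <= b ->
    ex_derive_on a b (Derive_n_on a b f n) x.

Definition strictly_monotone_on (a b : R) (G : R -> R) : Prop :=
  (forall x y : R, a <= x -> x < y -> y <= b -> G x < G y) \/
  (forall x y : R, a <= x -> x < y -> y <= b -> G y < G x).

(** [C] carries two module structures; derivatives with respect to a real
    variable use the one over [R], which has to be given explicitly. *)
Notation CR := C_R_CompleteNormedModule.

Definition Cexp (z : C) : C :=
  (exp (Re z) * cos (Im z), exp (Re z) * sin (Im z)).

Definition exp_term (G : R -> R) (H : R -> C) (alpha : C) (x : R) : C :=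
  (H x * Cexp (alpha * RtoC (G x)))%C.

Definition exp_sum (G : R -> R) (H : R -> C) (M : nat) (c alpha : nat -> C)
    (x : R) : C :=
  sum_n_m (fun j : nat => (c j * exp_term G H (alpha j) x)%C) 1 M.

Definition opA (a b : R) (G : R -> R) (H : R -> C) (f : R -> C) (x : R) : C :=
  let G' := RtoC (Derive_on a b G x) in
  (/ G' * Derive_on (V := CR) a b f x
   - Derive_on (V := CR) a b H x / (G' * H x) * f x)%C.

(** [L] is an operator on the smooth complex-valued functions on [a,b]. *)
Definition is_eigenfunction (a b : R) (L : (R -> C) -> R -> C)
    (phi : R -> C) : Prop :=
  smooth_on (V := CR) a b phi /\
  (exists x : R, a <= x <= b /\ phi x <> 0%C) /\
  exists lambda : C, forall x : R, a <= x <= b ->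
    L phi x = (lambda * phi x)%C.

Definition admissible (M : nat) (c alpha : nat -> C) : Prop :=
  (forall j : nat, (1 <= j <= M)%nat -> c j <> 0%C) /\
  (forall j k : nat, (1 <= j <= M)%nat -> (1 <= k <= M)%nat ->
     j <> k -> alpha j <> alpha k).

Definition param_pair (M : nat) (c alpha : nat -> C) (p : C * C) : Prop :=
  exists j : nat, (1 <= j <= M)%nat /\ p = (alpha j, c j).

(* Main.v *)
(** The difference of two expansions with the same samples is an expansion F
    with at most 2M exponents, possibly repeated, that vanishes at x0 to order
    2M. If F = sum_j d_j H e^(beta_j G) has N terms and vanishes at x0 to order
    N, then (A - beta_N) F = sum_(j<N) d_j (beta_j - beta_N) H e^(beta_j G) has
    N - 1 terms and vanishes to order N - 1. Induction on N gives
    sum_j d_j phi(beta_j) = 0 for every function phi on C, repetitions among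
    the beta_j being allowed; taking for phi the indicator of a point compares
    the parameters. *)

Require Import Defs.
From Stdlib Require Import Reals Lra Lia Classical.
From Coquelicot Require Import Coquelicot.
Open Scope R_scope.

(** * Finite weighted sums over exponents and comparison of parameters *)

(** The pairing of the measure [sum_j c_j delta_(beta_j)] on the complex plane with a test function
    [phi]. Evaluating an expansion at [x] is the case [phi z = exp_term G H z x]; a general [phi]
    sees the parameters themselves. *)
Definition weighted_sum (N : nat) (c beta : nat -> C) (phi : C -> C) : C :=
  sum_n_m (fun j => (c j * phi (beta j))%C) 1 N.

Lemma weighted_sum_0 (c beta : nat -> C) (phi : C -> C) :
  weighted_sum 0 c beta phi = 0%C.
Proof. apply (sum_n_m_zero (G := C_AbelianMonoid)); lia. Qed.

Lemma weighted_sum_S (N : nat) (c beta : nat -> C) (phi : C -> C) :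
  weighted_sum (S N) c beta phi =
  (weighted_sum N c beta phi + c (S N) * phi (beta (S N)))%C.
Proof. unfold weighted_sum; rewrite sum_n_Sm by lia; reflexivity. Qed.

Lemma weighted_sum_ext (N : nat) (c c' beta beta' : nat -> C) (phi phi' : C -> C) :
  (forall j, (1 <= j <= N)%nat -> (c j * phi (beta j) = c' j * phi' (beta' j))%C) ->
  weighted_sum N c beta phi = weighted_sum N c' beta' phi'.
Proof. intros E; apply (sum_n_m_ext_loc (G := C_AbelianMonoid)), E. Qed.

Lemma weighted_sum_linear (N : nat) (c beta : nat -> C) (phi psi : C -> C) (k : C) :
  weighted_sum N c beta (fun z => (phi z + k * psi z)%C) =
  (weighted_sum N c beta phi + k * weighted_sum N c beta psi)%C.
Proof.
  induction N as [|N IH]; [rewrite !weighted_sum_0; ring|].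
  rewrite !weighted_sum_S, IH; ring.
Qed.

Lemma weighted_sum_scale (N : nat) (c beta : nat -> C) (phi : C -> C) (k : C) :
  weighted_sum N (fun j => (k * c j)%C) beta phi = (k * weighted_sum N c beta phi)%C.
Proof.
  induction N as [|N IH]; [rewrite !weighted_sum_0; ring|].
  rewrite !weighted_sum_S, IH; ring.
Qed.

(** Joins the parameters of two expansions into one family, so that their difference is again a
    single expansion, with repeated exponents where the two share some. Indices start at 1, so [v 1]
    sits at [M + 1]. *)
Definition family_cat (M : nat) (u v : nat -> C) (j : nat) : C :=
  if Nat.leb j M then u j else v (j - M)%nat.

Lemma weighted_sum_cat (M N : nat) (c c' beta beta' : nat -> C) (phi : C -> C) :
  weighted_sum (M + N) (family_cat M c c') (family_cat M beta beta') phi =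
  (weighted_sum M c beta phi + weighted_sum N c' beta' phi)%C.
Proof.
  induction N as [|N IH].
  - rewrite Nat.add_0_r, weighted_sum_0, Cplus_0_r.
    apply weighted_sum_ext; intros j hj; unfold family_cat.
    rewrite (proj2 (Nat.leb_le j M)) by lia; reflexivity.
  - rewrite Nat.add_succ_r, !weighted_sum_S, IH; unfold family_cat.
    rewrite (proj2 (Nat.leb_gt (S (M + N)) M)) by lia.
    replace (S (M + N) - M)%nat with (S N) by lia; ring.
Qed.

Definition indicator (z w : C) : C := if Ceq_dec w z then RtoC 1 else RtoC 0.

Lemma weighted_sum_indicator_absent (N : nat) (c beta : nat -> C) (z : C) :
  (forall j, (1 <= j <= N)%nat -> beta j <> z) ->
  weighted_sum N c beta (indicator z) = 0%C.
Proof.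
  induction N as [|N IH]; intros hz; [apply weighted_sum_0|].
  rewrite weighted_sum_S, IH by (intros j hj; apply hz; lia).
  unfold indicator; destruct (Ceq_dec (beta (S N)) z) as [e|_]; [|ring].
  destruct (hz (S N) ltac:(lia) e).
Qed.

(** Since the exponents are distinct, only the [k]-th term survives the test. *)
Lemma weighted_sum_indicator (N : nat) (c beta : nat -> C) (k : nat) :
  (forall i j, (1 <= i <= N)%nat -> (1 <= j <= N)%nat -> i <> j -> beta i <> beta j) ->
  (1 <= k <= N)%nat ->
  weighted_sum N c beta (indicator (beta k)) = c k.
Proof.
  induction N as [|N IH]; intros hinj hk; [lia|].
  rewrite weighted_sum_S; unfold indicator at 2.
  destruct (Nat.eq_dec k (S N)) as [->|hkN].
  - rewrite weighted_sum_indicator_absent by (intros j hj; apply hinj; lia).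
    destruct (Ceq_dec (beta (S N)) (beta (S N))) as [_|n]; [ring|destruct (n eq_refl)].
  - rewrite IH by (try (intros; apply hinj); lia).
    destruct (Ceq_dec (beta (S N)) (beta k)) as [e|_]; [|ring].
    destruct (hinj (S N) k ltac:(lia) ltac:(lia) ltac:(lia) e).
Qed.

(** Testing both sums with the indicator of [alpha k] gives [c k], which is nonzero, on one side. So
    [alpha k] must occur among the [alpha'], and the same test then reads off its coefficient
    there. *)
Lemma param_pair_incl (M : nat) (c alpha c' alpha' : nat -> C) (p : C * C) :
  admissible M c alpha -> admissible M c' alpha' ->
  (forall phi, weighted_sum M c' alpha' phi = weighted_sum M c alpha phi) ->
  param_pair M c alpha p -> param_pair M c' alpha' p.
Proof.
  intros [hc hinj] [_ hinj'] E [k [hk ->]].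
  pose proof (E (indicator (alpha k))) as Ek.
  rewrite (weighted_sum_indicator M c alpha k hinj hk) in Ek.
  destruct (classic (exists j, (1 <= j <= M)%nat /\ alpha' j = alpha k)) as [[j [hj e]]|no].
  - exists j; split; [exact hj|].
    rewrite <- e, (weighted_sum_indicator M c' alpha' j hinj' hj) in Ek.
    rewrite e, Ek; reflexivity.
  - rewrite weighted_sum_indicator_absent in Ek.
    + destruct (hc k hk (eq_sym Ek)).
    + intros j hj e; apply no; exists j; split; assumption.
Qed.

(** * Differential calculus along the segment [a,b] *)

Section Calculus.

Variables a b : R.
Hypothesis hab : a < b.

Lemma within_segment_proper (x : R) (hx : a <= x <= b) :
  ProperFilter (within (fun y : R => a <= y <= b) (locally x)).
Proof.
  constructor.
  - intros P HP; exists x; exact (locally_singleton _ _ HP hx).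
  - apply within_filter, filter_filter.
Qed.

Lemma is_filter_lim_within (D : R -> Prop) (x : R) :
  is_filter_lim (within D (locally x)) x.
Proof. intros P HP; apply filter_imp with (2 := HP); intros y Hy _; exact Hy. Qed.

(** [filterdiff] quantifies over all limits of its filter; here [x] is the only one. *)
Lemma is_filter_lim_segment (x y : R) :
  a <= x <= b ->
  is_filter_lim (within (fun z : R => a <= z <= b) (locally x)) y -> y = x.
Proof.
  intros hx Hy; pose proof (within_segment_proper x hx) as HF.
  apply (is_filter_lim_unique (K := R_AbsRing) (V := R_NormedModule) (FF := Proper_StrongProper _ HF)).
  - exact Hy.
  - apply is_filter_lim_within.
Qed.

Lemma is_derive_on_ext {V : NormedModule R_AbsRing} (f g : R -> V) (x : R) (l : V) :
  a <= x <= b -> (forall y, a <= y <= b -> f y = g y) ->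
  is_derive_on a b f x l -> is_derive_on a b g x l.
Proof.
  intros hx E; unfold is_derive_on.
  apply filterdiff_ext_loc.
  (* Any radius works: the filter already restricts to [a,b], where [f] and [g] agree. *)
  - exists (mkposreal 1 Rlt_0_1); intros y _ hy; exact (E y hy).
  - intros y Hy; rewrite (is_filter_lim_segment x y hx Hy); exact (E x hx).
Qed.

(** Every point of [a,b], endpoints included, is an accumulation point of it; this is what makes
    derivatives along [a,b] unique. *)
Lemma segment_point_near (x d : R) :
  a <= x <= b -> 0 < d ->
  exists y, a <= y <= b /\ y <> x /\ Rabs (y - x) < d.
Proof.
  intros hx hd.
  (* As [2 * m <= b - a], at least one of [x + m] and [x - m] stays in [a,b]. *)
  set (m := Rmin d (b - a) / 2).
  assert (m1 : 0 < m) by (unfold m; apply Rmult_lt_0_compat; [apply Rmin_glb_lt|]; lra).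
  assert (m2 : 2 * m <= d) by (unfold m; pose proof (Rmin_l d (b - a)); lra).
  assert (m3 : 2 * m <= b - a) by (unfold m; pose proof (Rmin_r d (b - a)); lra).
  destruct (Rle_dec (x + m) b) as [h|h].
  - exists (x + m); repeat split; try lra.
    rewrite Rabs_pos_eq; lra.
  - exists (x - m); repeat split; try lra.
    rewrite Rabs_left; lra.
Qed.

(** Subtracting the two expansions of [f] shows that [(y - x) (l1 - l2)] is o(y - x). If [l1] and
    [l2] differed, half the norm of [l1 - l2] as epsilon would give a contradiction at a point [y]
    of [a,b] near [x]. *)
Lemma is_derive_on_unique {V : NormedModule R_AbsRing} (f : R -> V) (x : R) (l1 l2 : V) :
  a <= x <= b -> is_derive_on a b f x l1 -> is_derive_on a b f x l2 -> l1 = l2.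
Proof.
  intros hx H1 H2.
  pose proof (within_segment_proper x hx) as HF.
  pose proof (filterdiff_minus_fct _ _ _ _ H1 H2) as H3; clear H1 H2.
  destruct H3 as [_ H3]; specialize (H3 x (is_filter_lim_within _ x)).
  destruct (Req_dec (norm (minus l1 l2)) 0) as [E|E].
  { apply norm_eq_zero in E; apply (plus_reg_r (opp l2)); rewrite plus_opp_r; exact E. }
  exfalso.
  pose proof (norm_ge_0 (minus l1 l2)).
  assert (he : 0 < norm (minus l1 l2) / 2) by lra.
  specialize (H3 (mkposreal _ he)).
  destruct H3 as [d Hd].
  destruct (segment_point_near x d hx (cond_pos d)) as [y [hy [yx yd]]].
  specialize (Hd y yd hy); simpl pos in Hd.
  (* The function differentiated is [f - f], so its increment is zero and only the linear part
     remains. *)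
  rewrite !minus_eq_zero in Hd.
  unfold minus at 1 in Hd; rewrite plus_zero_l, norm_opp in Hd.
  assert (E2 : forall r : R, minus (scal r l1) (scal r l2) = scal r (minus l1 l2)).
  { intros r; symmetry; apply (scal_minus_distr_l (V := V)). }
  rewrite E2 in Hd.
  change (norm (scal (y - x) (minus l1 l2)) <= norm (minus l1 l2) / 2 * Rabs (y - x)) in Hd.
  assert (E3 : scal (/ (y - x)) (scal (y - x) (minus l1 l2)) = minus l1 l2).
  { rewrite scal_assoc; etransitivity; [|apply (scal_one (V := V))].
    f_equal; apply Rinv_l; lra. }
  assert (Hn : norm (minus l1 l2) <= Rabs (/ (y - x)) * norm (scal (y - x) (minus l1 l2))).
  { rewrite <- E3 at 1; apply (norm_scal (V := V)). }
  rewrite Rabs_inv in Hn.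
  pose proof (Rabs_pos_lt (y - x) ltac:(lra)) as Hp.
  pose proof (Rmult_le_compat_l (/ Rabs (y - x)) _ _ (Rlt_le _ _ (Rinv_0_lt_compat _ Hp)) Hd) as H1.
  replace (/ Rabs (y - x) * (norm (minus l1 l2) / 2 * Rabs (y - x)))
    with (norm (minus l1 l2) / 2) in H1 by (field; lra).
  lra.
Qed.

(** [iota] returns the intended value only for a predicate with exactly one solution, hence the
    appeal to uniqueness. *)
Lemma Derive_on_correct {V : CompleteNormedModule R_AbsRing} (f : R -> V) (x : R) :
  a <= x <= b -> ex_derive_on a b f x -> is_derive_on a b f x (Derive_on a b f x).
Proof.
  intros hx [l Hl]; apply (iota_correct (is_derive_on a b f x)); exists l; split; [exact Hl|].
  intros l' Hl'; exact (is_derive_on_unique f x l l' hx Hl Hl').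
Qed.

Lemma Derive_on_unique {V : CompleteNormedModule R_AbsRing} (f : R -> V) (x : R) (l : V) :
  a <= x <= b -> is_derive_on a b f x l -> Derive_on a b f x = l.
Proof.
  intros hx Hl; apply (is_derive_on_unique f x); [exact hx| |exact Hl].
  apply Derive_on_correct; [exact hx|exists l; exact Hl].
Qed.

Lemma is_derive_on_const {V : NormedModule R_AbsRing} (k : V) (x : R) :
  is_derive_on a b (fun _ => k) x zero.
Proof.
  apply (filterdiff_ext_lin _ (fun _ => zero)).
  - apply filterdiff_const.
  - intros y; symmetry; apply (scal_zero_r (V := V)).
Qed.

Lemma is_derive_on_plus {V : NormedModule R_AbsRing} (f g : R -> V) (x : R) (l m : V) :
  is_derive_on a b f x l -> is_derive_on a b g x m ->
  is_derive_on a b (fun y => plus (f y) (g y)) x (plus l m).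
Proof.
  intros Hf Hg.
  apply (filterdiff_ext_lin _ (fun y : R => plus (scal y l) (scal y m))).
  - exact (filterdiff_plus_fct _ _ _ _ Hf Hg).
  - intros y; symmetry; apply (scal_distr_l (V := V)).
Qed.

Lemma is_derive_on_opp {V : NormedModule R_AbsRing} (f : R -> V) (x : R) (l : V) :
  is_derive_on a b f x l -> is_derive_on a b (fun y => opp (f y)) x (opp l).
Proof.
  intros Hf.
  apply (filterdiff_ext_lin _ (fun y : R => opp (scal y l))).
  - exact (filterdiff_opp_fct _ _ Hf).
  - intros y; symmetry; apply (scal_opp_r (V := V)).
Qed.

Lemma is_derive_on_continuous (f : R -> R) (x l : R) :
  is_derive_on a b f x l ->
  filterlim f (within (fun y : R => a <= y <= b) (locally x)) (locally (f x)).
Proof.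
  intros Hf.
  apply (filterdiff_continuous_aux (U := R_NormedModule) (V := R_NormedModule) f).
  - exists (fun y : R => scal y l); exact Hf.
  - apply is_filter_lim_within.
Qed.

Lemma is_derive_on_comp (g f : R -> R) (x l m : R) :
  a <= x <= b -> is_derive_on a b f x l -> is_derive g (f x) m ->
  is_derive_on a b (fun y => g (f y)) x (l * m).
Proof.
  intros hx Hf Hg.
  pose proof (within_segment_proper x hx) as HF.
  apply (filterdiff_ext_lin _ (fun y : R => scal (scal y l) m)).
  - refine (filterdiff_comp f g _ (fun y => scal y m) Hf _).
    (* [g] has to be differentiated along the image filter of [f]; by continuity of [f] it converges
       to [f x], where [g] has an ordinary derivative. *)
    refine (filterdiff_locally (FF := filtermap_proper_filter _ _ f _ HF) _ (f x) _ _ Hg).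
    exact (is_derive_on_continuous f x l Hf).
  - intros y; symmetry; apply (scal_assoc (V := R_NormedModule)).
Qed.

Lemma is_derive_on_Rmult (f g : R -> R) (x l m : R) :
  a <= x <= b -> is_derive_on a b f x l -> is_derive_on a b g x m ->
  is_derive_on a b (fun y => f y * g y) x (l * g x + f x * m).
Proof.
  intros hx Hf Hg.
  pose proof (within_segment_proper x hx) as HF.
  apply (filterdiff_ext_lin _ (fun y : R => plus (mult (scal y l) (g x)) (mult (f x) (scal y m)))).
  - refine (filterdiff_comp_2 f g mult _ _ (fun u v => plus (mult u (g x)) (mult (f x) v)) Hf Hg _).
    refine (filterdiff_mult (FF := filtermap_proper_filter _ _ (fun t => (f t, g t)) _ HF) (f x, g x) _ Rmult_comm).
    assert (Cf := is_derive_on_continuous f x l Hf).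
    assert (Cg := is_derive_on_continuous g x m Hg).
    (* It remains to see that [(f t, g t)] tends to [(f x, g x)]; product balls reduce this to the
       two coordinates. *)
    intros P [eps HP].
    apply (filterlim_pair _ _ Cf Cg).
    exists (ball (f x) eps) (ball (g x) eps); try apply locally_ball.
    intros u v Hu Hv; apply HP; split; assumption.
  - intros y; unfold plus, mult, scal; simpl; unfold mult; simpl; ring.
Qed.

(** Both projections and the pairing map are linear over the reals. The complex product and
    exponential rules thereby reduce to real ones. *)
Lemma is_derive_on_C (f : R -> C) (x : R) (l : C) :
  is_derive_on (V := CR) a b f x l <->
  is_derive_on a b (fun y => Re (f y)) x (Re l) /\
  is_derive_on a b (fun y => Im (f y)) x (Im l).
Proof.
  split.
  - intros Hf; split.
    + exact (filterdiff_comp f _ _ _ Hf (filterdiff_linear _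
        (is_linear_fst (U := R_NormedModule) (V := R_NormedModule)))).
    + exact (filterdiff_comp f _ _ _ Hf (filterdiff_linear _
        (is_linear_snd (U := R_NormedModule) (V := R_NormedModule)))).
  - intros [H1 H2].
    apply (filterdiff_ext (V := C_R_NormedModule) (fun y => (Re (f y), Im (f y)))).
    { intros y; symmetry; apply surjective_pairing. }
    apply (filterdiff_ext_lin (V := C_R_NormedModule) _ (fun y : R => (scal y (Re l), scal y (Im l)))).
    + refine (filterdiff_comp_2 (U := R_NormedModule) (V := R_NormedModule) (W := C_R_NormedModule)
        _ _ (fun u v => (u, v)) _ _ (fun u v => (u, v)) H1 H2 _).
      apply (filterdiff_linear (V := C_R_NormedModule)).
      exact (is_linear_prod (T := prod_NormedModule R_AbsRing R_NormedModule R_NormedModule)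
        (U := R_NormedModule) (V := R_NormedModule) _ _ is_linear_fst is_linear_snd).
    + reflexivity.
Qed.

Lemma is_derive_on_RtoC (f : R -> R) (x l : R) :
  is_derive_on a b f x l -> is_derive_on (V := CR) a b (fun y => RtoC (f y)) x (RtoC l).
Proof.
  intros Hf; apply is_derive_on_C; split; [exact Hf|].
  exact (is_derive_on_const (V := R_NormedModule) 0 x).
Qed.

Lemma is_derive_on_Cmult (f g : R -> C) (x : R) (l m : C) :
  a <= x <= b ->
  is_derive_on (V := CR) a b f x l -> is_derive_on (V := CR) a b g x m ->
  is_derive_on (V := CR) a b (fun y => (f y * g y)%C) x (l * g x + f x * m)%C.
Proof.
  intros hx Hf Hg.
  apply is_derive_on_C in Hf; destruct Hf as [f1 f2].
  apply is_derive_on_C in Hg; destruct Hg as [g1 g2].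
  apply is_derive_on_C; split.
  - pose proof (is_derive_on_plus _ _ _ _ _ (is_derive_on_Rmult _ _ _ _ _ hx f1 g1)
      (is_derive_on_opp _ _ _ (is_derive_on_Rmult _ _ _ _ _ hx f2 g2))) as K.
    replace (Re (l * g x + f x * m)%C) with
     (plus (Re l * Re (g x) + Re (f x) * Re m) (opp (Im l * Im (g x) + Im (f x) * Im m))).
    + exact K.
    + unfold plus, opp, Re, Im; simpl; ring.
  - pose proof (is_derive_on_plus _ _ _ _ _ (is_derive_on_Rmult _ _ _ _ _ hx f1 g2)
      (is_derive_on_Rmult _ _ _ _ _ hx f2 g1)) as K.
    replace (Im (l * g x + f x * m)%C) with
     (plus (Re l * Im (g x) + Re (f x) * Im m) (Im l * Re (g x) + Im (f x) * Re m)).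
    + exact K.
    + unfold plus, opp, Re, Im; simpl; ring.
Qed.

Lemma is_derive_on_Cexp (f : R -> C) (x : R) (l : C) :
  a <= x <= b -> is_derive_on (V := CR) a b f x l ->
  is_derive_on (V := CR) a b (fun y => Cexp (f y)) x (l * Cexp (f x))%C.
Proof.
  intros hx Hf; apply is_derive_on_C in Hf; destruct Hf as [f1 f2].
  pose proof (is_derive_on_comp exp _ _ _ _ hx f1 (is_derive_exp _)) as He.
  pose proof (is_derive_on_comp cos _ _ _ _ hx f2 (is_derive_cos _)) as Hc.
  pose proof (is_derive_on_comp sin _ _ _ _ hx f2 (is_derive_sin _)) as Hs.
  apply is_derive_on_C; split.
  - pose proof (is_derive_on_Rmult _ _ _ _ _ hx He Hc) as K; simpl in K.
    replace (Re (l * Cexp (f x))%C) with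
      (Re l * exp (Re (f x)) * cos (Im (f x)) + exp (Re (f x)) * (Im l * - sin (Im (f x)))).
    + exact K.
    + unfold Re, Im; simpl; unfold Re, Im; ring.
  - pose proof (is_derive_on_Rmult _ _ _ _ _ hx He Hs) as K; simpl in K.
    replace (Im (l * Cexp (f x))%C) with
      (Re l * exp (Re (f x)) * sin (Im (f x)) + exp (Re (f x)) * (Im l * cos (Im (f x)))).
    + exact K.
    + unfold Re, Im; simpl; unfold Re, Im; ring.
Qed.


(** * Finite-order differentiability and its link to smoothness *)

Definition derivative_on {V : NormedModule R_AbsRing} (f f' : R -> V) : Prop :=
  forall x, a <= x <= b -> is_derive_on a b f x (f' x).

(** Derivatives are existential witnesses constrained only on [a,b], so sums and products get theirs
    directly from the calculus rules, without evaluating [Derive_on]. *)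
Fixpoint n_derivable_on {V : NormedModule R_AbsRing} (n : nat) (f : R -> V) : Prop :=
  match n with
  | O => True
  | S n => exists f', derivative_on f f' /\ n_derivable_on n f'
  end.

Lemma n_derivable_on_ext {V : NormedModule R_AbsRing} (n : nat) (f g : R -> V) :
  (forall x, a <= x <= b -> f x = g x) -> n_derivable_on n f -> n_derivable_on n g.
Proof.
  intros E; destruct n as [|n]; [trivial|].
  intros [f' [Hf Hn]]; exists f'; split; [|exact Hn].
  intros x hx; exact (is_derive_on_ext f g x _ hx E (Hf x hx)).
Qed.

Lemma n_derivable_on_pred {V : NormedModule R_AbsRing} (n : nat) (f : R -> V) :
  n_derivable_on (S n) f -> n_derivable_on n f.
Proof.
  revert f; induction n as [|n IH]; intros f; [intros _; exact I|].
  intros [f' [Hf Hn]]; exists f'; split; [exact Hf|exact (IH f' Hn)].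
Qed.

Lemma n_derivable_on_const {V : NormedModule R_AbsRing} (n : nat) (k : V) :
  n_derivable_on n (fun _ => k).
Proof.
  revert k; induction n as [|n IH]; intros k; [exact I|].
  exists (fun _ => zero); split; [|apply IH].
  intros x _; apply is_derive_on_const.
Qed.

Lemma n_derivable_on_plus {V : NormedModule R_AbsRing} (n : nat) (f g : R -> V) :
  n_derivable_on n f -> n_derivable_on n g -> n_derivable_on n (fun x => plus (f x) (g x)).
Proof.
  revert f g; induction n as [|n IH]; intros f g; [trivial|].
  intros [f' [Hf Hfn]] [g' [Hg Hgn]].
  exists (fun x => plus (f' x) (g' x)); split; [|exact (IH f' g' Hfn Hgn)].
  intros x hx; exact (is_derive_on_plus _ _ _ _ _ (Hf x hx) (Hg x hx)).
Qed.

Lemma n_derivable_on_Cmult (n : nat) (f g : R -> C) :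
  n_derivable_on (V := CR) n f -> n_derivable_on (V := CR) n g ->
  n_derivable_on (V := CR) n (fun x => (f x * g x)%C).
Proof.
  revert f g; induction n as [|n IH]; intros f g; [trivial|].
  intros Hf0 Hg0; pose proof Hf0 as [f' [Hf Hfn]]; pose proof Hg0 as [g' [Hg Hgn]].
  (* The derivative [f' * g + f * g'] still contains [f] and [g], which are needed to one order
     less. *)
  apply n_derivable_on_pred in Hf0; apply n_derivable_on_pred in Hg0.
  exists (fun x => (f' x * g x + f x * g' x)%C); split.
  - intros x hx; exact (is_derive_on_Cmult _ _ _ _ _ hx (Hf x hx) (Hg x hx)).
  - apply (n_derivable_on_plus (V := CR)); apply IH; assumption.
Qed.

Lemma n_derivable_on_Cexp (n : nat) (f : R -> C) :
  n_derivable_on (V := CR) n f -> n_derivable_on (V := CR) n (fun x => Cexp (f x)).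
Proof.
  revert f; induction n as [|n IH]; intros f; [trivial|].
  intros Hf0; pose proof Hf0 as [f' [Hf Hfn]]; apply n_derivable_on_pred in Hf0.
  exists (fun x => (f' x * Cexp (f x))%C); split.
  - intros x hx; exact (is_derive_on_Cexp _ _ _ hx (Hf x hx)).
  - apply n_derivable_on_Cmult; [exact Hfn|exact (IH f Hf0)].
Qed.

Lemma n_derivable_on_RtoC (n : nat) (f : R -> R) :
  n_derivable_on n f -> n_derivable_on (V := CR) n (fun x => RtoC (f x)).
Proof.
  revert f; induction n as [|n IH]; intros f; [trivial|].
  intros [f' [Hf Hn]]; exists (fun x => RtoC (f' x)); split; [|exact (IH f' Hn)].
  intros x hx; exact (is_derive_on_RtoC _ _ _ (Hf x hx)).
Qed.

(** The fixpoint adds derivatives on the outside; moving one to the inside lets inductions pass from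
    [f] to its derivative. *)
Lemma Derive_n_on_S {V : CompleteNormedModule R_AbsRing} (n : nat) (f : R -> V) :
  Derive_n_on a b f (S n) = Derive_n_on a b (Derive_on a b f) n.
Proof.
  induction n as [|n IH]; [reflexivity|].
  change (Derive_on a b (Derive_n_on a b f (S n)) = Derive_n_on a b (Derive_on a b f) (S n)).
  rewrite IH; reflexivity.
Qed.

Lemma smooth_on_derivative {V : CompleteNormedModule R_AbsRing} (f : R -> V) :
  smooth_on a b f -> derivative_on f (Derive_on a b f).
Proof. intros Hf x hx; exact (Derive_on_correct f x hx (Hf O x hx)). Qed.

Lemma smooth_on_Derive_on {V : CompleteNormedModule R_AbsRing} (f : R -> V) :
  smooth_on a b f -> smooth_on a b (Derive_on a b f).
Proof. intros Hf n x hx; rewrite <- Derive_n_on_S; exact (Hf (S n) x hx). Qed.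

Lemma smooth_on_n_derivable {V : CompleteNormedModule R_AbsRing} (n : nat) (f : R -> V) :
  smooth_on a b f -> n_derivable_on n f.
Proof.
  revert f; induction n as [|n IH]; intros f Hf; [exact I|].
  exists (Derive_on a b f); split; [exact (smooth_on_derivative f Hf)|].
  exact (IH _ (smooth_on_Derive_on f Hf)).
Qed.

Lemma n_derivable_smooth_on {V : CompleteNormedModule R_AbsRing} (f : R -> V) :
  (forall n, n_derivable_on n f) -> smooth_on a b f.
Proof.
  intros Hf n; specialize (Hf (S n)); revert f Hf.
  induction n as [|n IH]; intros f [f' [Hf Hn]] x hx.
  - exists (f' x); exact (Hf x hx).
  - rewrite Derive_n_on_S; apply IH; [|exact hx].
    (* The witness [f'] and [Derive_on a b f] are known to agree only on [a,b], which is enough for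
       differentiability there. *)
    apply (n_derivable_on_ext _ f'); [|exact Hn].
    intros y hy; symmetry; exact (Derive_on_unique f y _ hy (Hf y hy)).
Qed.

(** * Order of vanishing at the sample point *)

Variable x0 : R.
Hypothesis hx0 : a <= x0 <= b.

(** Peeling off one derivative at a time lets the product rule drive the inductions; the witness
    [f'] is determined on [a,b] by uniqueness. *)
Fixpoint vanishes_to_order (n : nat) (f : R -> C) : Prop :=
  match n with
  | O => True
  | S n => f x0 = 0%C /\
      exists f', derivative_on (V := CR) f f' /\ vanishes_to_order n f'
  end.

Lemma vanishes_to_order_ext (n : nat) (f g : R -> C) :
  (forall x, a <= x <= b -> f x = g x) ->
  vanishes_to_order n f -> vanishes_to_order n g.
Proof.
  intros E; destruct n as [|n]; [trivial|].
  intros [H0 [f' [Hf Hn]]]; split; [rewrite <- (E x0 hx0); exact H0|].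
  exists f'; split; [|exact Hn].
  intros x hx; exact (is_derive_on_ext (V := CR) f g x _ hx E (Hf x hx)).
Qed.

Lemma vanishes_to_order_pred (n : nat) (f : R -> C) :
  vanishes_to_order (S n) f -> vanishes_to_order n f.
Proof.
  revert f; induction n as [|n IH]; intros f; [intros _; exact I|].
  intros [H0 [f' [Hf Hn]]]; split; [exact H0|].
  exists f'; split; [exact Hf|exact (IH f' Hn)].
Qed.

Lemma vanishes_to_order_derivative (n : nat) (f f' : R -> C) :
  derivative_on (V := CR) f f' -> vanishes_to_order (S n) f -> vanishes_to_order n f'.
Proof.
  intros Hf [_ [g [Hg Hn]]]; apply (vanishes_to_order_ext n g); [|exact Hn].
  intros x hx; exact (is_derive_on_unique (V := CR) f x _ _ hx (Hg x hx) (Hf x hx)).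
Qed.

Lemma vanishes_to_order_plus (n : nat) (f g : R -> C) :
  vanishes_to_order n f -> vanishes_to_order n g ->
  vanishes_to_order n (fun x => (f x + g x)%C).
Proof.
  revert f g; induction n as [|n IH]; intros f g; [trivial|].
  intros [Hf0 [f' [Hf Hfn]]] [Hg0 [g' [Hg Hgn]]]; split.
  - rewrite Hf0, Hg0; ring.
  - exists (fun x => (f' x + g' x)%C); split; [|exact (IH f' g' Hfn Hgn)].
    intros x hx; exact (is_derive_on_plus (V := CR) _ _ _ _ _ (Hf x hx) (Hg x hx)).
Qed.

Lemma vanishes_to_order_mult (n : nat) (g f : R -> C) :
  n_derivable_on (V := CR) n g -> vanishes_to_order n f ->
  vanishes_to_order n (fun x => (g x * f x)%C).
Proof.
  revert g f; induction n as [|n IH]; intros g f; [trivial|].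
  intros Hg1 Hf1; pose proof Hg1 as [g' [Hg Hgn]]; pose proof Hf1 as [Hf0 [f' [Hf Hfn]]].
  apply n_derivable_on_pred in Hg1; apply vanishes_to_order_pred in Hf1.
  split; [rewrite Hf0; ring|].
  exists (fun x => (g' x * f x + g x * f' x)%C); split.
  - intros x hx; exact (is_derive_on_Cmult _ _ _ _ _ hx (Hg x hx) (Hf x hx)).
  - apply vanishes_to_order_plus; apply IH; assumption.
Qed.

(** By induction [f] vanishes to order [n], hence so does [g * f' = (g * f)' - g' * f], and the
    induction hypothesis applies again to [f']. The value [f x0] is zero because [g x0] is not. *)
Lemma vanishes_to_order_cancel (n : nat) (g f : R -> C) :
  g x0 <> 0%C -> n_derivable_on (V := CR) n g -> n_derivable_on (V := CR) n f ->
  vanishes_to_order n (fun x => (g x * f x)%C) -> vanishes_to_order n f.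
Proof.
  intros g0; revert g g0 f; induction n as [|n IH]; intros g g0 f; [trivial|].
  intros Hg1 Hf1 Hgf.
  pose proof Hg1 as [g' [Hg Hgn]]; pose proof Hf1 as [f' [Hf Hfn]].
  apply n_derivable_on_pred in Hg1; apply n_derivable_on_pred in Hf1.
  assert (Hv : vanishes_to_order n f)
    by (apply (IH g g0 f Hg1 Hf1), vanishes_to_order_pred, Hgf).
  assert (Hd : derivative_on (V := CR) (fun x => (g x * f x)%C)
    (fun x => (g' x * f x + g x * f' x)%C))
    by (intros x hx; exact (is_derive_on_Cmult _ _ _ _ _ hx (Hg x hx) (Hf x hx))).
  split.
  - destruct (Ceq_dec (f x0) 0) as [E|E]; [exact E|].
    destruct (Cmult_neq_0 _ _ g0 E (proj1 Hgf)).
  - exists f'; split; [exact Hf|].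
    apply (IH g g0 f' Hg1 Hfn).
    apply (vanishes_to_order_ext n (fun x => ((g' x * f x + g x * f' x)
      + RtoC (-1) * (g' x * f x))%C)).
    + intros x _; ring.
    + apply vanishes_to_order_plus.
      * exact (vanishes_to_order_derivative n _ _ Hd Hgf).
      * apply vanishes_to_order_mult; [apply (n_derivable_on_const (V := CR))|].
        apply vanishes_to_order_mult; assumption.
Qed.

Lemma vanishes_to_order_sub (n : nat) (f g : R -> C) :
  smooth_on (V := CR) a b f -> smooth_on (V := CR) a b g ->
  (forall l, (l < n)%nat ->
    Derive_n_on (V := CR) a b f l x0 = Derive_n_on (V := CR) a b g l x0) ->
  vanishes_to_order n (fun x => (f x - g x)%C).
Proof.
  revert f g; induction n as [|n IH]; intros f g Hf Hg E; [exact I|]; split.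
  - pose proof (E O ltac:(lia)) as E0; simpl in E0; rewrite E0; ring.
  - exists (fun x => (Derive_on (V := CR) a b f x - Derive_on (V := CR) a b g x)%C); split.
    + intros x hx.
      exact (is_derive_on_plus (V := CR) _ _ _ _ _ (smooth_on_derivative _ Hf x hx)
        (is_derive_on_opp (V := CR) _ _ _ (smooth_on_derivative _ Hg x hx))).
    + apply IH; [exact (smooth_on_Derive_on _ Hf)|exact (smooth_on_Derive_on _ Hg)|].
      intros l hl; rewrite <- !Derive_n_on_S; apply E; lia.
Qed.

(** * Exponential sums and the action of the operator *)

Variables (G : R -> R) (H : R -> C).
Hypothesis hG : smooth_on a b G.
Hypothesis hH : smooth_on (V := CR) a b H.

Lemma exp_term_derivative (beta : C) :
  derivative_on (V := CR) (exp_term G H beta) (fun x =>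
    (Derive_on (V := CR) a b H x * Cexp (beta * RtoC (G x))
     + beta * RtoC (Derive_on a b G x) * exp_term G H beta x)%C).
Proof.
  intros x hx.
  assert (D1 : is_derive_on (V := CR) a b (fun y => (beta * RtoC (G y))%C) x
      (zero * RtoC (G x) + beta * RtoC (Derive_on a b G x))%C).
  { exact (is_derive_on_Cmult (fun _ => beta) (fun y => RtoC (G y)) x _ _ hx
      (is_derive_on_const (V := CR) beta x)
      (is_derive_on_RtoC G x _ (smooth_on_derivative G hG x hx))). }
  pose proof (is_derive_on_Cmult _ _ _ _ _ hx (smooth_on_derivative _ hH x hx)
    (is_derive_on_Cexp _ _ _ hx D1)) as D2.
  unfold exp_term.
  match type of D2 with is_derive_on _ _ _ _ ?l => match goal with
    |- is_derive_on _ _ _ _ ?m => replace m with l; [exact D2|] end end.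
  change (zero : C) with (RtoC 0); ring.
Qed.

Lemma exp_term_smooth (beta : C) : smooth_on (V := CR) a b (exp_term G H beta).
Proof.
  apply n_derivable_smooth_on; intros n.
  apply n_derivable_on_Cmult; [exact (smooth_on_n_derivable (V := CR) n H hH)|].
  apply n_derivable_on_Cexp, (n_derivable_on_Cmult n (fun _ => beta) (fun x => RtoC (G x))).
  - apply (n_derivable_on_const (V := CR)).
  - exact (n_derivable_on_RtoC n G (smooth_on_n_derivable n G hG)).
Qed.

Lemma exp_sum_weighted_sum (N : nat) (c beta : nat -> C) (x : R) :
  exp_sum G H N c beta x = weighted_sum N c beta (fun z => exp_term G H z x).
Proof. reflexivity. Qed.

Lemma exp_sum_smooth (N : nat) (c beta : nat -> C) :
  smooth_on (V := CR) a b (exp_sum G H N c beta).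
Proof.
  apply n_derivable_smooth_on; intros n; induction N as [|N IH].
  - apply (n_derivable_on_ext (V := CR) n (fun _ => zero)).
    + intros x _; symmetry; exact (weighted_sum_0 c beta (fun z => exp_term G H z x)).
    + apply (n_derivable_on_const (V := CR)).
  - apply (n_derivable_on_ext (V := CR) n
      (fun x => plus (exp_sum G H N c beta x) (c (S N) * exp_term G H (beta (S N)) x)%C)).
    + intros x _; symmetry; exact (weighted_sum_S N c beta (fun z => exp_term G H z x)).
    + apply (n_derivable_on_plus (V := CR) n _ _ IH).
      apply (n_derivable_on_Cmult n (fun _ => c (S N))).
      * apply (n_derivable_on_const (V := CR)).
      * exact (smooth_on_n_derivable (V := CR) n _ (exp_term_smooth _)).
Qed.

(** This is the action of [A] on expansions, [c j] becoming [c j * beta j], multiplied through by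
    [G' H]: it says [F' H - H' F = G' H (A F)]. *)
Lemma exp_sum_derivative (N : nat) (c beta : nat -> C) (x : R) :
  a <= x <= b ->
  (Derive_on (V := CR) a b (exp_sum G H N c beta) x * H x =
   Derive_on (V := CR) a b H x * exp_sum G H N c beta x
   + RtoC (Derive_on a b G x) * H x * exp_sum G H N (fun j => c j * beta j) beta x)%C.
Proof.
  intros hx; induction N as [|N IH].
  - assert (D0 : is_derive_on (V := CR) a b (exp_sum G H 0 c beta) x zero).
    { apply (is_derive_on_ext (V := CR) (fun _ => zero) _ x zero hx).
      - intros y _; symmetry; exact (weighted_sum_0 c beta (fun z => exp_term G H z y)).
      - apply (is_derive_on_const (V := CR)). }
    rewrite (Derive_on_unique (V := CR) _ x _ hx D0), !exp_sum_weighted_sum, !weighted_sum_0.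
    change (zero : C) with (RtoC 0); ring.
  - pose proof (is_derive_on_plus (V := CR) _ _ _ _ _
      (smooth_on_derivative (V := CR) _ (exp_sum_smooth N c beta) x hx)
      (is_derive_on_Cmult _ _ _ _ _ hx (is_derive_on_const (V := CR) (c (S N)) x)
        (exp_term_derivative (beta (S N)) x hx))) as DS.
    apply (is_derive_on_ext (V := CR) _ (exp_sum G H (S N) c beta) _ _ hx) in DS;
      [|intros y _; symmetry; exact (weighted_sum_S N c beta (fun z => exp_term G H z y))].
    rewrite (Derive_on_unique (V := CR) _ x _ hx DS).
    rewrite !exp_sum_weighted_sum in *; rewrite !weighted_sum_S; clear DS.
    match goal with |- (plus ?u ?v * ?h = _)%C =>
      change (plus u v) with (u + v)%C; rewrite (Cmult_plus_distr_r u v h), IH end.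
    change (zero : C) with (RtoC 0); unfold exp_term; ring.
Qed.

Hypothesis hG' : forall x, a <= x <= b -> Derive_on a b G x <> 0.
Hypothesis hH0 : forall x, a <= x <= b -> H x <> 0%C.

(** [exp] is positive, and sine and cosine have no common zero. *)
Lemma Cexp_neq_0 (z : C) : Cexp z <> 0%C.
Proof.
  intros E; injection E as E1 E2.
  pose proof (exp_pos (Re z)) as He; pose proof (sin2_cos2 (Im z)) as Hs; unfold Rsqr in Hs.
  apply Rmult_integral in E1; apply Rmult_integral in E2.
  destruct E1 as [E1|E1], E2 as [E2|E2]; try lra.
  rewrite E1, E2 in Hs; lra.
Qed.

Lemma exp_term_neq_0 (beta : C) (x : R) : a <= x <= b -> exp_term G H beta x <> 0%C.
Proof. intros hx; exact (Cmult_neq_0 _ _ (hH0 x hx) (Cexp_neq_0 _)). Qed.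

(** The eigenvalue is [beta]: the part of the derivative coming from [H'] is exactly what the second
    term of [A] removes. *)
Lemma exp_term_eigenfunction (beta : C) :
  is_eigenfunction a b (opA a b G H) (exp_term G H beta).
Proof.
  split; [apply exp_term_smooth|split].
  - exists x0; split; [exact hx0|exact (exp_term_neq_0 beta x0 hx0)].
  - exists beta; intros x hx; unfold opA.
    rewrite (Derive_on_unique (V := CR) _ x _ hx (exp_term_derivative beta x hx)).
    unfold exp_term; field; split; [exact (hH0 x hx)|].
    intros E; apply RtoC_inj in E; exact (hG' x hx E).
Qed.

(* The operator [A - beta0] is used in the form
   [F |-> F' H - H' F - beta0 G' H F = G' H (A F - beta0 F)],
   which avoids derivatives of quotients. *)
Lemma vanishes_to_order_exp_sum_shift (n N : nat) (c beta : nat -> C) (beta0 : C) :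
  vanishes_to_order (S n) (exp_sum G H N c beta) ->
  vanishes_to_order n (exp_sum G H N (fun j => c j * (beta j - beta0))%C beta).
Proof.
  intros Hv.
  pose proof (vanishes_to_order_derivative _ _ _
    (smooth_on_derivative (V := CR) _ (exp_sum_smooth N c beta)) Hv) as Hd.
  apply vanishes_to_order_pred in Hv.
  pose proof (smooth_on_n_derivable (V := CR) n _ hH) as nH.
  pose proof (smooth_on_n_derivable (V := CR) n _ (smooth_on_Derive_on (V := CR) _ hH)) as nH'.
  pose proof (n_derivable_on_RtoC n _
    (smooth_on_n_derivable n _ (smooth_on_Derive_on _ hG))) as nG'.
  pose proof (n_derivable_on_Cmult n _ _ nG' nH) as nG'H.
  apply (vanishes_to_order_cancel n (fun x => (RtoC (Derive_on a b G x) * H x)%C)).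
  - apply Cmult_neq_0; [|exact (hH0 x0 hx0)].
    intros E; apply RtoC_inj in E; exact (hG' x0 hx0 E).
  - exact nG'H.
  - exact (smooth_on_n_derivable (V := CR) n _ (exp_sum_smooth _ _ _)).
  - apply (vanishes_to_order_ext n (fun x =>
      (H x * Derive_on (V := CR) a b (exp_sum G H N c beta) x
       + (RtoC (-1) * (Derive_on (V := CR) a b H x * exp_sum G H N c beta x)
          + (- beta0) * (RtoC (Derive_on a b G x) * H x * exp_sum G H N c beta x)))%C)).
    + intros x hx.
      rewrite (Cmult_comm (H x)), (exp_sum_derivative N c beta x hx).
      replace (exp_sum G H N (fun j => c j * (beta j - beta0))%C beta x)
        with (exp_sum G H N (fun j => c j * beta j)%C beta x
              + (- beta0) * exp_sum G H N c beta x)%C; [ring|].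
      rewrite !exp_sum_weighted_sum.
      (* The factor [beta j] moves from the coefficients into the test function, so that linearity
         in the test function applies. *)
      rewrite (weighted_sum_ext N (fun j => c j * beta j)%C c beta beta
        _ (fun z => z * exp_term G H z x)%C) by (intros; ring).
      rewrite <- weighted_sum_linear.
      apply weighted_sum_ext; intros; ring.
    + repeat apply vanishes_to_order_plus; repeat apply vanishes_to_order_mult;
        try apply (n_derivable_on_const (V := CR)); assumption.
Qed.

(** * Recovery of the parameters from the order of vanishing *)

Lemma exp_sum_vanishes_weighted_sum (N : nat) (c beta : nat -> C) :
  vanishes_to_order N (exp_sum G H N c beta) ->
  forall phi, weighted_sum N c beta phi = 0%C.
Proof.
  revert c; induction N as [|N IH]; intros c Hv phi; [apply weighted_sum_0|].
  set (beta0 := beta (S N)).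
  set (k := (phi beta0 / exp_term G H beta0 x0)%C).
  (* [r beta0 = 0], and the correction term contributes a multiple of the value
     of the sum at [x0], which is [0]. *)
  set (r := fun z => (phi z + - k * exp_term G H z x0)%C).
  assert (r0 : r beta0 = 0%C).
  { unfold r, k; field; exact (exp_term_neq_0 beta0 x0 hx0). }
  assert (Hr : weighted_sum (S N) c beta r = 0%C).
  { rewrite weighted_sum_S; fold beta0; rewrite r0, Cmult_0_r, Cplus_0_r.
    (* Each term is multiplied and divided by [beta j - beta0], which turns the coefficients into
       those of [(A - beta0) F]. *)
    rewrite (weighted_sum_ext N c (fun j => c j * (beta j - beta0))%C beta beta
      r (fun z => r z / (z - beta0))%C).
    - apply IH.
      apply (vanishes_to_order_ext N
        (exp_sum G H (S N) (fun j => c j * (beta j - beta0))%C beta)).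
      (* The last coefficient is now [c (S N) * (beta0 - beta0) = 0], so one term drops out. *)
      + intros x _; rewrite exp_sum_weighted_sum, weighted_sum_S; fold beta0.
        rewrite exp_sum_weighted_sum; ring.
      + apply vanishes_to_order_exp_sum_shift, Hv.
    (* For a repeated exponent [beta j = beta0] both sides vanish, whatever value the division by
       zero takes, because [r beta0 = 0]. *)
    - intros j _; destruct (Ceq_dec (beta j) beta0) as [e|ne].
      + rewrite e, r0; unfold Cdiv; ring.
      + field; intros E; apply ne; rewrite <- (Cplus_0_r beta0), <- E; ring. }
  unfold r in Hr; rewrite weighted_sum_linear in Hr.
  rewrite <- exp_sum_weighted_sum, (proj1 Hv) in Hr.
  rewrite <- Hr; ring.
Qed.

Lemma weighted_sum_eq_of_samples (M : nat) (c alpha c' alpha' : nat -> C) :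
  (1 <= M)%nat ->
  (forall l, (l <= 2 * M - 1)%nat ->
     Derive_n_on (V := CR) a b (exp_sum G H M c' alpha') l x0
     = Derive_n_on (V := CR) a b (exp_sum G H M c alpha) l x0) ->
  forall phi, weighted_sum M c' alpha' phi = weighted_sum M c alpha phi.
Proof.
  intros hM E phi.
  (* Negated coefficients make the concatenated expansion the difference of the two. *)
  set (m := fun j => (RtoC (-1) * c j)%C).
  assert (Hv : vanishes_to_order (M + M)
    (exp_sum G H (M + M) (family_cat M c' m) (family_cat M alpha' alpha))).
  { apply (vanishes_to_order_ext _
      (fun x => (exp_sum G H M c' alpha' x - exp_sum G H M c alpha x)%C)).
    - intros x _; rewrite !exp_sum_weighted_sum, weighted_sum_cat; unfold m.
      rewrite weighted_sum_scale; ring.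
    (* Vanishing to order [M + M] involves the derivatives of orders 0 to [2 * M - 1], which are
       exactly the given samples. *)
    - apply vanishes_to_order_sub; try apply exp_sum_smooth.
      intros l hl; apply E; lia. }
  pose proof (exp_sum_vanishes_weighted_sum _ _ _ Hv phi) as Z.
  rewrite weighted_sum_cat in Z; unfold m in Z; rewrite weighted_sum_scale in Z.
  rewrite <- (Cplus_0_r (weighted_sum M c alpha phi)), <- Z; ring.
Qed.

End Calculus.

Theorem theorem1 (a b : R) (M : nat) (G : R -> R) (H : R -> C) (x0 : R)
    (c alpha : nat -> C)
    (hab : a < b) (hM : (1 <= M)%nat)
    (hGsmooth : smooth_on a b G) (hHsmooth : smooth_on (V := CR) a b H)
    (hGmono : strictly_monotone_on a b G)
    (hG' : forall x : R, a <= x <= b -> Derive_on a b G x <> 0)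
    (hH : forall x : R, a <= x <= b -> H x <> 0%C)
    (hx0 : a <= x0 <= b)
    (hcalpha : admissible M c alpha) :
  (forall j : nat, (1 <= j <= M)%nat ->
     is_eigenfunction a b (opA a b G H) (exp_term G H (alpha j)))
  /\
  (forall c' alpha' : nat -> C,
     admissible M c' alpha' ->
     (forall l : nat, (l <= 2 * M - 1)%nat ->
        Derive_n_on (V := CR) a b (exp_sum G H M c' alpha') l x0
        = Derive_n_on (V := CR) a b (exp_sum G H M c alpha) l x0) ->
     (forall p : C * C, param_pair M c' alpha' p <-> param_pair M c alpha p)
     /\
     (forall x : R, a <= x <= b ->
        exp_sum G H M c' alpha' x = exp_sum G H M c alpha x)).
Proof.
  split.
  - intros j _.
    exact (exp_term_eigenfunction a b hab x0 hx0 G H hGsmooth hHsmooth hG' hH (alpha j)).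
  - intros c' alpha' hcalpha' E.
    pose proof (weighted_sum_eq_of_samples a b hab x0 hx0 G H hGsmooth hHsmooth hG' hH
      M c alpha c' alpha' hM E) as W.
    split.
    + intros p; split; apply param_pair_incl; try assumption.
      intros phi; symmetry; apply W.
    (* Equality of the functions is the case of the test function evaluating an exponential term at
       [x]. *)
    + intros x _; exact (W (fun z => exp_term G H z x)).
Qed.
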